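(* Let $\Lambda\subseteq\mathcal{F}$ be finite and downward closed. Then for every $\varepsilon\in(0,\mathrm{e}^{-1})$ there exists a ReLU neural network $\Phi=\{\tilde H_{\varepsilon,\nu}\}_{\nu\in\Lambda}:\mathbb{R}^{|\operatorname{supp}\Lambda|}\to\mathbb{R}^{|\Lambda|}$ such that $$\max_{\nu\in\Lambda}\|H_\nu-\tilde H_{\varepsilon,\nu}\|_{L^2(U,\gamma)}\le\varepsilon,$$ and there exists a positive constant $C$ (independent of $m(\Lambda)$, $d(\Lambda)$ and of $\varepsilon\in(0,\mathrm{e}^{-1})$) such that $$\operatorname{size}(\Phi)\le C\,|\Lambda|\,m(\Lambda)^3\log(1+m(\Lambda))\,d(\Lambda)^2\log(\varepsilon^{-1}),$$ $$\operatorname{depth}(\Phi)\le C\,m(\Lambda)\log(1+m(\Lambda))^2\,d(\Lambda)\log(1+d(\Lambda))\log(\varepsilon^{-1}).$$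
   Context: $\mathbb{N}=\{1,2,\dots\}$, $\mathbb{N}_0=\{0,1,2,\dots\}$. $U:=\mathbb{R}^{\mathbb{N}}$, and $\gamma:=\bigotimes_{j\in\mathbb{N}}\gamma_1$ is the infinite product on $U$ of the standard Gaussian measure $\gamma_1$ on $\mathbb{R}$. Multi-indices: for $\nu\in\mathbb{N}_0^{\mathbb{N}}$, $|\nu|=|\nu|_1:=\sum_j\nu_j$, $\operatorname{supp}\nu:=\{j:\nu_j\neq0\}$, $|\nu|_0:=\#\operatorname{supp}\nu$; $\mathcal{F}:=\{\nu\in\mathbb{N}_0^{\mathbb{N}}:|\nu|<\infty\}$. $\mu\le\nu$ means $\mu_j\le\nu_j$ for all $j$. $\Lambda\subseteq\mathcal{F}$ is downward closed if $\nu\in\Lambda$ implies $\mu\in\Lambda$ whenever $\mu\le\nu$. For finite $\Lambda$, $\operatorname{supp}\Lambda:=\bigcup_{\nu\in\Lambda}\operatorname{supp}\nu$, $m(\Lambda):=\max_{\nu\in\Lambda}|\nu|_1$ (maximum order) and $d(\Lambda):=\sup_{\nu\in\Lambda}|\nu|_0$ (effective dimension). $|\Lambda|$ and $|\operatorname{supp}\Lambda|$ denote cardinalities. Hermite polynomials: $H_n(x)=\frac{(-1)^n}{\sqrt{n!}}\mathrm{e}^{x^2/2}\frac{d^n}{dx^n}\mathrm{e}^{-x^2/2}$ for $n\in\mathbb{N}_0$ (normalized in $L^2(\mathbb{R},\gamma_1)$), and $H_\nu(y):=\prod_{j\in\operatorname{supp}\nu}H_{\nu_j}(y_j)$ for $\nu\in\mathcal{F}$,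 $y\in U$ (empty product $=1$). Neural networks: with $\sigma(x)=\max\{x,0\}$ (ReLU), applied componentwise, a ReLU neural network $\Phi:\mathbb{R}^{n_0}\to\mathbb{R}^{n_{L+1}}$ is a map represented as $\Phi=A_L\circ\sigma\circ\cdots\circ\sigma\circ A_0$ with affine maps $A_j(x)=W_jx+b_j$ (no skip connections). $\operatorname{depth}(\Phi)=L$ is the number of applications of $\sigma$, and $\operatorname{size}(\Phi)$ is the total number of nonzero entries of all $W_j$ and $b_j$. The inputs of $\Phi$ are $(y_j)_{j\in\operatorname{supp}\Lambda}$, its output components are the functions $\tilde H_{\varepsilon,\nu}$, $\nu\in\Lambda$, and each $\tilde H_{\varepsilon,\nu}$ is regarded as a function of $y\in U$ depending only on these coordinates.
   Formalization: The size bound is claimed only for Λ ≠ {0}: for Λ = {0} one has m(Λ) = d(Λ) = 0, so the bound would force a size-0 (identically zero) network, whose error against H_0 = 1 is 1 > ε; the error and depth bounds are still claimed for Λ = {0}. *)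

(* Defs.v *)
From HB Require Import structures.
From mathcomp Require Import all_boot all_order all_algebra finmap.
From mathcomp Require Import all_classical all_reals all_analysis.

Set Implicit Arguments.
Unset Strict Implicit.
Unset Printing Implicit Defensive.

Import Order.TTheory GRing.Theory Num.Theory.
Import numFieldNormedType.Exports.

Local Open Scope classical_set_scope.
Local Open Scope ring_scope.

(* Coordinates are numbered from 0, so that the index set N of U = R^N is nat. *)

Definition multiindex := {fsfun nat -> nat with 0%N}.

Definition mi_order (nu : multiindex) : nat := (\sum_(j <- finsupp nu) nu j)%N.

Definition mi_le (mu nu : multiindex) : Prop := forall j, (mu j <= nu j)%N.

Definition downward_closed (Lambda : {fset multiindex}) : Prop :=
  forall nu mu : multiindex, nu \in Lambda -> mi_le mu nu -> mu \in Lambda.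

Definition suppset (Lambda : {fset multiindex}) : {fset nat} :=
  (\bigcup_(nu <- Lambda) finsupp nu)%fset.

Definition max_order (Lambda : {fset multiindex}) : nat :=
  (\max_(nu <- Lambda) mi_order nu)%N.

Definition eff_dim (Lambda : {fset multiindex}) : nat :=
  (\max_(nu <- Lambda) #|` finsupp nu|)%N.

Section Gaussian.
Variable R : realType.

Definition coord_cylinders : set (set (nat -> R)) :=
  [set A | exists (j : nat) (B : set (measurableTypeR R)),
    measurable B /\ A = (fun y : nat -> R => y j) @^-1` B].

(* R^N with the product sigma-algebra *)
Definition seqspace := g_sigma_algebraType coord_cylinders.

(* gamma is the infinite product of the standard Gaussian measure
   (expectation 0, standard deviation 1); these values on the cylinder sets
   determine gamma uniquely. *)
Definition is_gaussian_product (gamma : probability seqspace R) : Prop :=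
  forall (J : {fset nat}) (B : nat -> set (measurableTypeR R)),
    (forall j, measurable (B j)) ->
    gamma [set y : seqspace | forall j, j \in J -> B j (y j)] =
    (\prod_(j <- J) normal_prob 0 1 (B j))%E.

End Gaussian.

Section Hermite.
Variable R : realType.

Definition hermite (n : nat) (x : R) : R :=
  (-1) ^+ n / Num.sqrt (n`!)%:R * expR (x ^+ 2 / 2) *
  derive1n n (fun t : R => expR (- (t ^+ 2 / 2))) x.

Definition hermite_mi (nu : multiindex) (y : nat -> R) : R :=
  \prod_(j <- finsupp nu) hermite (nu j) (y j).

End Hermite.

Section Networks.
Variable R : realType.

(* [Layer W b Phi] represents Phi o sigma o (x |-> W x + b), so a network with
   L layers above its final affine map is A_L o sigma o ... o sigma o A_0. *)
Inductive relu_net : nat -> nat -> Type :=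
| Affine n m (W : 'M[R]_(m, n)) (b : 'cV[R]_m) : relu_net n m
| Layer n k m (W : 'M[R]_(k, n)) (b : 'cV[R]_k) (Phi : relu_net k m) :
    relu_net n m.

Definition relu (x : R) : R := Num.max x 0.

Fixpoint realize n m (Phi : relu_net n m) : 'cV[R]_n -> 'cV[R]_m :=
  match Phi with
  | Affine _ _ W b => fun x => W *m x + b
  | Layer _ _ _ W b Psi => fun x => realize Psi (map_mx relu (W *m x + b))
  end.

Fixpoint net_depth n m (Phi : relu_net n m) : nat :=
  match Phi with
  | Affine _ _ _ _ => 0%N
  | Layer _ _ _ _ _ Psi => (net_depth Psi).+1
  end.

Definition nnz m n (A : 'M[R]_(m, n)) : nat :=
  #|[set ij : 'I_m * 'I_n | A ij.1 ij.2 != 0]%SET|.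

Fixpoint net_size n m (Phi : relu_net n m) : nat :=
  match Phi with
  | Affine _ _ W b => (nnz W + nnz b)%N
  | Layer _ _ _ W b Psi => (nnz W + nnz b + net_size Psi)%N
  end.

(* The finite types suppset Lambda and Lambda index the inputs and the outputs
   of the network through their canonical enumerations. *)
Definition restrict_supp (Lambda : {fset multiindex}) (y : nat -> R) :
    'cV[R]_#|{: suppset Lambda}| :=
  \col_i y (val (enum_val i)).

Definition net_component (Lambda : {fset multiindex})
    (Phi : relu_net #|{: suppset Lambda}| #|{: Lambda}|) (nu : Lambda)
    (y : nat -> R) : R :=
  realize Phi (restrict_supp Lambda y) (enum_rank nu) 0.

End Networks.

(* Main.v *)
Require Import Defs.
From mathcomp Require Import all_boot all_order all_algebra finmap.
From mathcomp Require Import all_classical all_reals all_analysis.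
From mathcomp Require Import measurable_realfun complex ring lra zify.

Set Implicit Arguments.
Unset Strict Implicit.
Unset Printing Implicit Defensive.

Import Order.TTheory GRing.Theory Num.Theory.
Import numFieldNormedType.Exports.

Local Open Scope ring_scope.

(** The Hermite polynomial of degree n has n real roots, all of absolute value
    at most n, so each H_nu is, up to a factor at most 1 in absolute value, a
    product of |nu| affine factors y_j - z.  The network multiplies these
    factors, padded by ones to N = 2^l with max_order <= N <= 2 max_order, along
    a balanced binary tree.  All components run through the same tree in
    parallel; they differ in the weights of the first layer and in the scale of
    the output.

    One product is computed by polarization,
    a b = (|a + b| / 2)^2 - (|a - b| / 2)^2, and a square on [0,1] by k
    compositions of the tooth function, each of which divides the error by 4
    ([square_state], [level_product]).  The factors, bounded by some K, are
    divided by 2K and thus at most 1/2 in absolute value; then every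
    intermediate value stays at most 1/2 and an error is never amplified on its
    way to the root of the tree: the total error is at most (2K)^N N 4^(-k)
    ([product_tree], [factor_net]).  A network of this shape has l levels of
    depth k + 2 and O(N k) weights for each component.

    The approximation is accurate only where |y_j| <= M for all j in supp nu;
    the scaled factors are clipped, so elsewhere the network is bounded by
    about (2K)^N.  With r = max |y_j| > M the squared error is then at most
    9 (4r)^(2N), and as soon as M is a large multiple of N ln(1/eps) this is
    dominated by a small multiple of exp(r^2/4), hence by the sum over j of the
    same multiple of exp(y_j^2/4).  Each term depends on one coordinate and has
    integral sqrt 2, so only the one-dimensional marginals of the measure enter
    ([pointwise_bound], [Lnorm2_le]).

    With K = 2M and M = 64 N ln(1/eps), accuracy eps needs
    k ~ N ln(256 N ln(1/eps)) + 2N + ln(1/eps), which is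
    O(m ln(1+m) ln(1/eps)) for m = max_order, and l = O(ln(1+m))
    ([tree_parameters]). *)

(** * Real roots of the Hermite polynomials *)

(** The probabilists' Hermite polynomials, monic and not normalized. *)
Fixpoint hermite_poly (R : realDomainType) (n : nat) : {poly R} :=
  if n is k.+1 then 'X * hermite_poly R k - (hermite_poly R k)^`() else 1.

Lemma logarithmic_derivative (F : fieldType) (s : seq F) (z : F) :
  z \notin s ->
  (\prod_(x <- s) ('X - x%:P))^`().[z] =
  (\prod_(x <- s) ('X - x%:P)).[z] * \sum_(x <- s) (z - x)^-1.
Proof.
elim: s => [|x s IH]; first by rewrite !big_nil derivC hornerC mulr0.
rewrite inE negb_or => /andP[zx zs]; rewrite !big_cons derivM derivXsubC mul1r.
rewrite !(hornerD, hornerM, hornerXsubC, hornerN, hornerC, hornerX) IH //.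
have : z - x != 0 by rewrite subr_eq0.
by move: (\sum_(_ <- _) _) => S nz; field.
Qed.

(** The equation holds for the zeros of X p - p' that are not zeros of the
    polynomial p with roots s.  If Im z were nonzero, Im (z - x)^-1 would
    have the opposite sign for all x, so taking imaginary parts gives
    (Im z)^2 <= 0. *)
Lemma critical_point_real (R : rcfType) (s : seq R) (z : R[i]) :
  z = \sum_(x <- s) (z - x%:C%C)^-1 -> complex.Im z = 0.
Proof.
move=> zE; suff: complex.Im z ^+ 2 <= 0.
  by rewrite real_exprn_even_le0 ?num_real // => /eqP.
rewrite expr2 {2}zE; elim: s {zE} => [|x s IH]; first by rewrite big_nil mulr0.
rewrite big_cons.
have ImD (u v : R[i]) : complex.Im (u + v) = complex.Im u + complex.Im v.
  by case: u; case: v.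
rewrite ImD mulrDr -[leRHS]addr0 lerD //.
case: z {IH} => a b /=.
rewrite oppr0 addr0 mulrN oppr_le0 mulrA -expr2 mulr_ge0 ?sqr_ge0 //.
by rewrite invr_ge0 addr_ge0 ?sqr_ge0.
Qed.

(** One step of the recursion of [hermite_poly] keeps all roots real: a root of
    X p - p' that is not a root of p satisfies z = p'(z) / p(z), which is the
    sum of the (z - x)^-1.  Such a z is real by [critical_point_real], and if it
    were at distance more than 1 from all roots of p, the sum, and hence z,
    would be smaller in absolute value than their number. *)
Lemma hermite_step_roots (R : rcfType) (s : seq R) :
  {in s, forall x, `|x| <= (size s)%:R} ->
  exists2 r : seq R,
    'X * (\prod_(x <- s) ('X - x%:P)) - (\prod_(x <- s) ('X - x%:P))^`()
      = \prod_(x <- r) ('X - x%:P) &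
    size r = (size s).+1 /\ {in r, forall x, `|x| <= (size s).+1%:R}.
Proof.
move=> sB; set p := \prod_(x <- s) _; set q := 'X * p - p^`().
have p_monic : p \is monic by apply: monic_prod_XsubC.
have szp : size p = (size s).+1 by apply: size_prod_XsubC.
have szXp : size ('X * p) = (size s).+2.
  by rewrite mulrC size_mulX ?monic_neq0 // szp.
have szp' : (size (- p^`()) < size ('X * p)%R)%N.
  rewrite size_polyN szXp (leq_trans (lt_size_deriv _)) ?monic_neq0 ?szp //.
have q_monic : q \is monic.
  by rewrite monicE lead_coefDl // lead_coefM lead_coefX mul1r (monicP p_monic).
have szq : size q = (size s).+2 by rewrite size_polyDl.
have rootE (z : R[i]) : root (map_poly (real_complex R) q) z ->
    z \in [seq x%:C%C | x <- s] \/ z = \sum_(x <- s) (z - x%:C%C)^-1.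
  move=> qz; have [|zs] := boolP (z \in _); [by left | right].
  have := logarithmic_derivative zs; rewrite !big_map.
  move: qz; rewrite /root rmorphB rmorphM /= map_polyX -deriv_map.
  rewrite rmorph_prod /=; under eq_bigr do rewrite map_polyXsubC.
  set P := \prod_(_ <- s) _ => qz dz; move: qz.
  rewrite hornerD hornerN hornerM hornerX dz subr_eq0 mulrC => /eqP/mulfI; apply.
  rewrite /P horner_prod prodf_seq_neq0; apply/allP => x xs /=.
  rewrite hornerXsubC subr_eq0; apply: contra zs => /eqP ->.
  exact: map_f.
have [r qr] := closed_field_poly_normal (map_poly (real_complex R) q).
have qCm : lead_coef (map_poly (real_complex R) q) = 1.
  by rewrite lead_coef_map (monicP q_monic) rmorph1.
rewrite qCm scale1r in qr.
have r_root z : z \in r -> root (map_poly (real_complex R) q) z.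
  by rewrite qr root_prod_XsubC.
have r_real : r = [seq x%:C%C | x <- [seq complex.Re z | z <- r]].
  rewrite -map_comp -[LHS]map_id; apply/eq_in_map => z zr /=.
  case: (rootE _ (r_root z zr)) => [/mapP[x _ ->] //|/critical_point_real].
  by case: z {zr} => a b /= ->.
exists [seq complex.Re z | z <- r].
  apply: (map_poly_inj (real_complex R)); rewrite /= -/q qr {1}r_real.
  rewrite rmorph_prod !big_map /=.
  by apply: eq_bigr => x _; rewrite map_polyXsubC.
split.
  rewrite size_map; apply: succn_inj; rewrite -(size_prod_XsubC _ id) -qr.
  by rewrite size_map_poly szq.
move=> x /mapP[z zr xE]; have zx : z = x%:C%C.
  move: zr; rewrite r_real => /mapP[y _ zE]; rewrite xE zE //.
case: (rootE _ (r_root z zr)) => [/mapP[y ys]|].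
  by rewrite zx => -[->]; rewrite (le_trans (sB _ ys)) // ler_nat.
move=> zE; have {zE} xS : x = \sum_(y <- s) (x - y)^-1.
  apply: (@complexI R); rewrite -[LHS]zx zE rmorph_sum; apply: eq_bigr => y _.
  by rewrite zx /= -rmorphB -fmorphV.
rewrite leNgt; apply/negP => xB.
suff : `|x| <= (size s)%:R.
  by rewrite leNgt (lt_trans _ xB) // ltr_nat.
rewrite {1}xS; apply: le_trans (ler_norm_sum _ _ _) _.
rewrite -sum1_size natr_sum; rewrite !big_seq; apply: ler_sum => y ys.
rewrite normfV invf_le1.
  have := lerB_dist x y; have := sB _ ys; move: xB; rewrite -natr1; lra.
have := lerB_dist x y; have := sB _ ys; move: xB; rewrite -natr1; lra.
Qed.

Lemma hermite_poly_roots (R : rcfType) n :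
  exists s : seq R, [/\ hermite_poly R n = \prod_(x <- s) ('X - x%:P),
    size s = n & {in s, forall x, `|x| <= n%:R}].
Proof.
elim: n => [|n [s [pE szs sB]]]; first by exists [::]; rewrite big_nil.
have [|r rE [szr rB]] := @hermite_step_roots _ s; first by rewrite szs.
by exists r; rewrite /= pE rE szr -szs.
Qed.

(** Differentiating q(t) exp(-t^2/2) replaces q by q' - t q, which is the
    recursion of [hermite_poly] up to sign. *)
Lemma derive1n_gaussian (R : realType) n :
  derive1n n (fun t : R => expR (- (t ^+ 2 / 2))) =
  fun t => (-1) ^+ n * (hermite_poly R n).[t] * expR (- (t ^+ 2 / 2)).
Proof.
elim: n => [|n IH].
  by apply/funext => t; rewrite derive1n0 expr0 /= hornerC !mul1r.
rewrite derive1nS IH; apply/funext => x.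
set p := hermite_poly R n; pose q : {poly R} := - 2^-1 *: 'X^2.
have qE (t : R) : q.[t] = - (t ^+ 2 / 2).
  by rewrite /q hornerZ hornerXn mulNr mulrC.
have q'E (t : R) : q^`().[t] = - t.
  by rewrite /q derivZ derivXn hornerZ hornerMn hornerXn expr1; field.
have dg : is_derive x 1 (expR \o horner q) (expR q.[x] * q^`().[x]).
  exact: is_derive1_comp.
have := @is_deriveM _ _ _ _ _ _ _ _ (is_derive_poly p x) dg.
move=> /(@is_deriveZ _ _ _ _ ((-1) ^+ n)) dpg.
have -> : (fun t => (-1) ^+ n * p.[t] * expR (- (t ^+ 2 / 2))) =
   ((-1) ^+ n \*: (horner p * (expR \o horner q)))%R.
  by apply/funext => t; rewrite -qE -mulrA.
rewrite derive1E derive_val /GRing.scale /= qE q'E !exprS.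
rewrite hornerD hornerN hornerM hornerX -/p.
by ring.
Qed.

Lemma hermite_factored (R : realType) n :
  exists s : seq R, [/\ size s = n, {in s, forall x, `|x| <= n%:R} &
    forall x, hermite n x = (Num.sqrt n`!%:R)^-1 * \prod_(z <- s) (x - z)].
Proof.
have [s [pE sz sB]] := hermite_poly_roots R n; exists s; split=> // x.
rewrite /hermite derive1n_gaussian /= pE horner_prod.
under eq_bigr do rewrite hornerXsubC.
set P := \prod_(_ <- _) _.
have E1 : expR (x ^+ 2 / 2) * expR (- (x ^+ 2 / 2)) = 1 :> R.
  by rewrite -expRD subrr expR0.
have S1 : (-1) ^+ n * (-1) ^+ n = 1 :> R.
  by rewrite -exprMn mulrNN mulr1 expr1n.
move: E1 S1.
move: (expR (x ^+ 2 / 2)) (expR (- _)) ((-1) ^+ n) (Num.sqrt _)^-1 => e e1 u r E1 S1.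
transitivity ((u * u) * (e * e1) * (r * P)); first by ring.
by rewrite E1 S1 !mul1r.
Qed.

(** * ReLU networks with sparse rows *)

Section Nets.
Variable R : realType.

(** The coefficients and the bias of one neuron.  A list of weighted inputs
    makes the number of nonzero weights visible as its length; an input may
    occur several times. *)
Definition sparse_row (I : finType) : Type := seq (R * I) * R.

Definition row_eval (I : finType) (r : sparse_row I) (x : I -> R) : R :=
  \sum_(p <- r.1) p.1 * x p.2 + r.2.

Definition row_scale (I : finType) (c : R) (r : sparse_row I) : sparse_row I :=
  ([seq (c * p.1, p.2) | p <- r.1], c * r.2).

Definition row_add (I : finType) (r1 r2 : sparse_row I) : sparse_row I :=
  (r1.1 ++ r2.1, r1.2 + r2.2).

Lemma row_eval_scale (I : finType) c (r : sparse_row I) x :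
  row_eval (row_scale c r) x = c * row_eval r x.
Proof.
rewrite /row_eval mulrDr mulr_sumr big_map; congr (_ + _).
by apply: eq_bigr => p _; rewrite mulrA.
Qed.

Lemma row_eval_add (I : finType) (r1 r2 : sparse_row I) x :
  row_eval (row_add r1 r2) x = row_eval r1 x + row_eval r2 x.
Proof. by rewrite /row_eval big_cat addrACA. Qed.

Definition rows_mx (I J : finType) (r : J -> sparse_row I) : 'M[R]_(#|J|, #|I|) :=
  \matrix_(j, i) \sum_(p <- (r (enum_val j)).1 | p.2 == enum_val i) p.1.

Definition rows_bias (I J : finType) (r : J -> sparse_row I) : 'cV[R]_#|J| :=
  \col_j (r (enum_val j)).2.

Lemma rows_mxE (I J : finType) (r : J -> sparse_row I) (x : I -> R) :
  rows_mx r *m (\col_i x (enum_val i)) + rows_bias r =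
  \col_j row_eval (r (enum_val j)) x.
Proof.
apply/matrixP => j k; rewrite !mxE /row_eval; congr (_ + _).
under eq_bigr do rewrite !mxE mulr_suml.
rewrite (exchange_big_dep xpredT) //=; apply: eq_bigr => p _.
rewrite (big_pred1 (enum_rank p.2)) ?enum_rankK // => i /=.
by rewrite eq_sym (can2_eq enum_valK enum_rankK).
Qed.

Lemma rows_size (I J : finType) (r : J -> sparse_row I) c :
  (forall j, (size (r j).1 <= c)%N) ->
  (nnz (rows_mx r) + nnz (rows_bias r) <= #|J| * c.+1)%N.
Proof.
move=> rc; rewrite mulnS addnC leq_add //.
  by rewrite (leq_trans (max_card _)) // card_prod !card_ord muln1.
rewrite /nnz -sum1dep_card.
rewrite -(pair_big_dep xpredT (fun i j => rows_mx r i j != 0) (fun _ _ => 1%N)) /=.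
rewrite -[X in (_ <= X * _)%N](card_ord #|J|) -sum_nat_const.
apply: leq_sum => j _; rewrite sum1dep_card.
apply: leq_trans (rc (enum_val j)).
rewrite -(size_map (fun p => enum_rank p.2)); apply: leq_trans (card_size _).
apply: subset_leq_card; apply/fintype.subsetP => i; rewrite inE => /eqP nz.
apply/negPn/negP => ni; apply: nz; rewrite mxE big1_seq // => p /andP[/eqP pi pr].
by case/negP: ni; apply/mapP; exists p => //; rewrite pi enum_valK.
Qed.

(** Neurons are indexed by arbitrary finite types, so that parallel copies of a
    network are products of index types and no block matrices are needed. *)
Definition realizable (I O : finType) (f : (I -> R) -> O -> R) (d s : nat) : Prop :=
  exists Phi : relu_net R #|I| #|O|,
    [/\ net_depth Phi = d, (net_size Phi <= s)%N &
      forall x o, realize Phi (\col_i x (enum_val i)) (enum_rank o) 0 = f x o].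

Lemma realizable_affine (I O : finType) (r : O -> sparse_row I) c :
  (forall o, (size (r o).1 <= c)%N) ->
  realizable (fun x o => row_eval (r o) x) 0 (#|O| * c.+1).
Proof.
move=> rc; exists (Affine (rows_mx r) (rows_bias r)); split=> //.
  exact: rows_size.
by move=> x o; rewrite [LHS]/= rows_mxE mxE enum_rankK.
Qed.

Definition relu_layer (I J : finType) (r : J -> sparse_row I) (x : I -> R) (j : J) :=
  relu (row_eval (r j) x).

(** Layers are added at the input side.  Since each ends with the activation,
    composition merges no affine maps, and depth and size are additive. *)
Lemma realizable_layer (I J O : finType) (r : J -> sparse_row I) c
    (g : (J -> R) -> O -> R) d s :
  (forall j, (size (r j).1 <= c)%N) -> realizable g d s ->
  realizable (fun x => g (relu_layer r x)) d.+1 (#|J| * c.+1 + s).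
Proof.
move=> rc [Phi [<- szPhi gE]].
exists (Layer (rows_mx r) (rows_bias r) Phi); split=> //=.
  by rewrite leq_add // rows_size.
move=> x o; rewrite rows_mxE -gE; congr (realize Phi _ _ _).
by apply/matrixP => i j; rewrite !mxE.
Qed.

Lemma realizable_weaken (I O : finType) (f : (I -> R) -> O -> R) d d' s s' :
  d = d' -> (s <= s')%N -> realizable f d s -> realizable f d' s'.
Proof.
by move=> <- ss' [Phi [? ? ?]]; exists Phi; split=> //; apply: leq_trans ss'.
Qed.

Lemma realizable_iter (I O : finType) (r : I -> sparse_row I) c k
    (g : (I -> R) -> O -> R) d s :
  (forall i, (size (r i).1 <= c)%N) -> realizable g d s ->
  realizable (fun x => g (iter k (relu_layer r) x)) (k + d) (k * (#|I| * c.+1) + s).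
Proof.
move=> rc; elim: k g d s => [//|k IH] g d s gd.
apply: realizable_weaken (IH _ _ _ (realizable_layer rc gd)).
  by rewrite addnS.
by rewrite mulSn addnCA addnA.
Qed.

Lemma relu_ge0 (x : R) : 0 <= x -> relu x = x.
Proof. by move=> x0; rewrite /relu max_l. Qed.

Lemma relu_le0 (x : R) : x <= 0 -> relu x = 0.
Proof. by move=> x0; rewrite /relu max_r. Qed.

Lemma reluN_add (x : R) : relu x + relu (- x) = `|x|.
Proof.
have [x0|x0] := ger0P x.
  by rewrite relu_ge0 // relu_le0 ?oppr_le0 // addr0.
by rewrite relu_le0 ?(ltW x0) // relu_ge0 ?add0r // oppr_ge0 ltW.
Qed.

Section Square.
Variable Q : finType.

(** For each q in Q the three neurons hold s, relu (s - 1/2) and an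
    accumulator; 2 s - 4 relu (s - 1/2) is the tooth function of s on [0,1]. *)
Definition tooth_row (i : Q * option bool) : sparse_row (Q * option bool)%type :=
  let: (q, o) := i in
  match o with
  | Some true => ([:: (2, (q, Some true)); (- 4, (q, Some false))], 0)
  | Some false => ([:: (2, (q, Some true)); (- 4, (q, Some false))], - 2^-1)
  | None => ([:: (4, (q, None)); (- 2, (q, Some true)); (4, (q, Some false))], 0)
  end.

(** After k steps the accumulator differs from 4^k x^2 only by s - s^2, which
    is at most 1/4.  This is preserved because the tooth function g satisfies
    4 (s - s^2) = g(s) + (g(s) - g(s)^2).  Scaling the accumulator by 4^k makes
    all steps the same layer. *)
Definition square_state (x : R) (k : nat) (st : option bool -> R) : Prop :=
  exists s : R, [/\ 0 <= s <= 1, st (Some true) = s,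
    st (Some false) = relu (s - 2^-1) & st None = 4 ^+ k * x ^+ 2 + s - s ^+ 2].

Lemma tooth_layer_state (z : Q * option bool -> R) q x k :
  square_state x k (fun o => z (q, o)) ->
  square_state x k.+1 (fun o => relu_layer tooth_row z (q, o)).
Proof.
case=> s [/andP[s0 s1] st sf sn].
pose s' := 2 * s - 4 * relu (s - 2^-1).
have s'E : (s' = 2 * s /\ s <= 2^-1) \/ (s' = 2 - 2 * s /\ 2^-1 <= s).
  rewrite /s'; have [h|h] := lerP s 2^-1; [left|right].
    by rewrite relu_le0; lra.
  by rewrite relu_ge0; lra.
have s'01 : 0 <= s' <= 1 by lra.
have s'2 : 4 * s - 4 * s ^+ 2 - s' = s' - s' ^+ 2.
  by case: s'E => -[-> _]; rewrite !expr2; ring.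
have x0 : 0 <= 4 ^+ k * x ^+ 2 by rewrite mulr_ge0 ?sqr_ge0 ?exprn_ge0.
exists s'; split => //; rewrite /relu_layer /row_eval /= ?big_cons ?big_nil /= ?st ?sf.
- by rewrite relu_ge0 /s'; move: s'01; rewrite /s'; lra.
- by congr (relu _); rewrite /s'; lra.
- rewrite sn (exprS 4 k); set y := 4 ^+ k * x ^+ 2 in x0 *.
  have y' : 4 * 4 ^+ k * x ^+ 2 = 4 * y by rewrite /y mulrA.
  rewrite y'; transitivity (relu (4 * y + (s' - s' ^+ 2))).
    by congr (relu _); rewrite -s'2 /s'; lra.
  rewrite relu_ge0; first by rewrite addrA.
  have : 0 <= s' * (1 - s') by rewrite mulr_ge0; lra.
  by rewrite mulrBr mulr1 -expr2; lra.
Qed.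

Lemma iter_tooth_state (z : Q * option bool -> R) q x k :
  square_state x 0 (fun o => z (q, o)) ->
  square_state x k (fun o => iter k (relu_layer tooth_row) z (q, o)).
Proof. by move=> z0; elim: k => [//|k IH]; apply: tooth_layer_state. Qed.

Lemma square_state_error x k (st : option bool -> R) :
  square_state x k st -> x ^+ 2 <= 4 ^- k * st None <= x ^+ 2 + 4 ^- k / 4.
Proof.
case=> s [/andP[s0 s1] _ _ ->].
have k0 : 0 < 4 ^+ k :> R by rewrite exprn_gt0.
rewrite -addrA mulrDr mulKf ?gt_eqF //.
have ss0 : 0 <= s - s ^+ 2 by rewrite expr2; nra.
have ss1 : s - s ^+ 2 <= 4^-1 by have := sqr_ge0 (s - 2^-1); rewrite !expr2; lra.
apply/andP; split; first by rewrite lerDl mulr_ge0 // invr_ge0 ltW.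
by rewrite lerD2l ler_pM2l ?invr_gt0.
Qed.

End Square.
End Nets.

(** * A balanced tree of approximate products *)

Section Tree.
Variable R : realType.

Section Level.
Variables (I Q : finType) (r : Q * bool -> sparse_row R I).

(** The neuron (q, e, sgn) holds the positive or negative part of
    (a + b) / 2 or (a - b) / 2, where a and b are the two values to be
    multiplied. *)
Definition half_sum_row (j : (Q * bool) * bool) : sparse_row R I :=
  let: ((q, e), sgn) := j in
  row_scale ((-1) ^+ sgn / 2)
    (row_add (r (q, true)) (row_scale ((-1) ^+ e) (r (q, false)))).

(** Adds positive and negative part, which yields the absolute value, and
    initializes the three neurons of [tooth_row] with it. *)
Definition fold_row (j : (Q * bool) * option bool) :
    sparse_row R ((Q * bool) * bool)%type :=
  let: (q, o) := j in
  ([:: (1, (q, true)); (1, (q, false))], if o is Some false then - 2^-1 else 0).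

Lemma fold_row_eval w q o : row_eval (fold_row (q, o)) w =
  w (q, true) + w (q, false) - (if o is Some false then 2^-1 else 0).
Proof.
rewrite /row_eval /= !big_cons big_nil /= !mul1r addr0; congr (_ + _).
by case: o => [[]|]; rewrite ?oppr0.
Qed.

Definition product_row k (q : Q) : sparse_row R ((Q * bool) * option bool)%type :=
  ([:: (4 ^- k, ((q, false), None)); (- 4 ^- k, ((q, true), None))], 0).

(** Since the readout [product_row] is affine, it is absorbed into the first
    layer of the next level. *)
Definition level_state k (x : I -> R) : (Q * bool) * option bool -> R :=
  iter k (relu_layer (@tooth_row R _)) (relu_layer fold_row (relu_layer half_sum_row x)).

Lemma realizable_level (O : finType) k (g : _ -> O -> R) d s :
  (forall i, (size (r i).1 <= 2)%N) -> realizable g d s ->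
  realizable (fun x => g (level_state k x)) (d + k.+2) (s + #|Q| * (38 + 24 * k)).
Proof.
move=> r2 gds.
have step : realizable (fun x => g (iter k (relu_layer (@tooth_row R _)) x))
    (k + d) (k * (#|{: (Q * bool) * option bool}| * 4) + s).
  by apply: realizable_iter gds => -[q [[]|]].
have r4 j : (size (half_sum_row j).1 <= 4)%N.
  case: j => [[q e] b] /=; rewrite size_map size_cat size_map.
  by have := r2 (q, true); have := r2 (q, false); lia.
have f2 j : (size (fold_row j).1 <= 2)%N by case: j.
apply: realizable_weaken (realizable_layer r4 (realizable_layer f2 step)).
  lia.
rewrite !card_prod card_option card_bool; lia.
Qed.

(** The bound 1/2 reproduces itself on the next level: the exact product is at
    most 1/4 in absolute value, and so is the approximation error. *)
Lemma level_product k x q :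
  (0 < k)%N -> (forall i, `|row_eval (r i) x| <= 2^-1) ->
  let p := row_eval (product_row k q) (level_state k x) in
  let ab := row_eval (r (q, false)) x * row_eval (r (q, true)) x in
  `|p| <= 2^-1 /\ `|p - ab| <= 4 ^- k.
Proof.
move=> k0 rx p ab.
set b := row_eval (r (q, false)) x in ab *; set a := row_eval (r (q, true)) x in ab *.
have a2 : - 2^-1 <= a <= 2^-1 by rewrite -ler_norml rx.
have b2 : - 2^-1 <= b <= 2^-1 by rewrite -ler_norml rx.
have st (e : bool) : square_state `|(a + (-1) ^+ e * b) / 2| 0
    (fun o => relu_layer fold_row (relu_layer half_sum_row x) ((q, e), o)).
  set c := `|_|.
  have c01 : 0 <= c <= 1.
    rewrite /c normr_ge0 /= ler_norml; case: e {c}; rewrite ?expr0 ?expr1; lra.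
  have cE : relu_layer half_sum_row x (q, e, true) +
      relu_layer half_sum_row x (q, e, false) = c.
    rewrite /relu_layer /half_sum_row !row_eval_scale row_eval_add row_eval_scale.
    rewrite /c -reluN_add addrC /= expr0 expr1.
    by congr (relu _ + relu _); rewrite -/a -/b; field.
  exists c; rewrite /relu_layer -/(relu_layer half_sum_row x) !fold_row_eval.
  case/andP: (c01) => c0 _; rewrite -[X in relu X]/(_ + _) cE; split=> //.
  - by rewrite subr0 relu_ge0.
  - by rewrite subr0 relu_ge0 // expr0 mul1r addrAC subrr add0r.
have sq e := square_state_error (iter_tooth_state k (st e)).
have abE : ab = ((a + (-1) ^+ false * b) / 2) ^+ 2 - ((a + (-1) ^+ true * b) / 2) ^+ 2.
  by rewrite expr0 expr1 /ab; field.
have pE : p = 4 ^- k * level_state k x (q, false, None)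
    - 4 ^- k * level_state k x (q, true, None).
  by rewrite /p /row_eval !big_cons big_nil /= mulNr !addr0.
have k4pos : 0 < 4 ^+ k :> R by rewrite exprn_gt0.
have k4 : 4 <= 4 ^+ k :> R by rewrite -[leLHS]expr1 ler_eXn2l // ltr1n.
have {}k4 : 4 ^- k <= 4^-1 :> R by rewrite lef_pV2 ?posrE.
have {}k4pos : 0 < 4 ^- k :> R by rewrite invr_gt0.
move: k4 k4pos (sq false) (sq true); rewrite !real_normK ?num_real //.
rewrite -/(level_state k x).
have ab4 : `|ab| <= 4^-1.
  rewrite normrM (_ : 4^-1 = 2^-1 * 2^-1); last by field.
  by apply: ler_pM; rewrite ?normr_ge0 // rx.
move: ab4; rewrite !ler_norml abE pE.
move: (4 ^- k) (_ ^+ 2) (_ ^+ 2) (4 ^- k * level_state _ _ (_, true, _))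
  (4 ^- k * level_state _ _ _) => E C D A B.
lra.
Qed.

End Level.

(** The leaves of a complete binary tree of depth l.  The last boolean selects
    the factor in a pair multiplied on the lowest level. *)
Fixpoint leaves (l : nat) : finType :=
  if l is n.+1 then (leaves n * bool)%type else unit.

Lemma card_leaves l : #|leaves l| = (2 ^ l)%N.
Proof.
by elim: l => [|l IH]; [rewrite card_unit | rewrite card_prod card_bool IH expnSr].
Qed.

(** Telescoping x1 x2 - y1 y2 = x1 (x2 - y2) + (x1 - y1) y2: as long as the
    factors are at most 1, errors only add up. *)
Lemma prod_dist_le (L : finType) (a b : L -> R) e :
  (forall l, `|a l| <= 1) -> (forall l, `|b l| <= 1) ->
  (forall l, `|a l - b l| <= e) ->
  `|\prod_l a l - \prod_l b l| <= #|L|%:R * e.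
Proof.
move=> a1 b1 ab; rewrite (_ : _ * e = \sum_(l : L) e); last first.
  by rewrite sumr_const mulr_natl.
pose K (x y z : R) := [/\ `|x| <= 1, `|y| <= 1 & `|x - y| <= z].
suff [] : K (\prod_l a l) (\prod_l b l) (\sum_(l : L) e) by [].
apply: (big_ind3 K) => [|x1 x2 x3 y1 y2 y3 [? ? ?] [? ? ?]|l _].
- by rewrite /K normr1 subrr normr0.
- split; first by rewrite normrM mulr_ile1.
    by rewrite normrM mulr_ile1.
  rewrite (_ : _ - _ = x1 * (y1 - y2) + (x1 - x2) * y2); last by ring.
  apply: le_trans (ler_normD _ _) _; rewrite addrC !normrM.
  rewrite lerD //; first by rewrite (le_trans _ (_ : `|x1 - x2| <= _)) // ler_piMr.
  by rewrite (le_trans _ (_ : `|y1 - y2| <= _)) // ler_piMl.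
- by [].
Qed.

(** For each t, a level with 2^n outputs costs O(2^n k) weights, and its errors
    contribute 2^n 4^(-k) to the product; both are geometric sums over the levels. *)
Lemma product_tree k l (I T : finType) (r : T * leaves l -> sparse_row R I)
    (scale : T -> R) :
  (0 < k)%N -> (forall i, (size (r i).1 <= 2)%N) ->
  exists F : (I -> R) -> T -> R,
    realizable F (l * k.+2) (#|T| * (2 ^ l * (38 + 24 * k) + 3)) /\
    forall x, (forall i, `|row_eval (r i) x| <= 2^-1) ->
      forall t, `|F x t - scale t * \prod_i row_eval (r (t, i)) x|
        <= `|scale t| * (2 ^+ l / 4 ^+ k).
Proof.
move=> k0; elim: l I r => [|l IH] I r r2.
  exists (fun x t => row_eval (row_scale (scale t) (r (t, tt))) x); split.
    apply: realizable_weaken (realizable_affine (c := 2) _) => //; first lia.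
    by move=> t; rewrite size_map.
  move=> x rx t; rewrite row_eval_scale (big_pred1 tt); last by case.
  by rewrite subrr normr0 mulr_ge0 // divr_ge0 // exprn_ge0.
pose r' (i : (T * leaves l) * bool) := r (i.1.1, (i.1.2, i.2)).
have [|F [Fds Fx]] := IH _ (product_row (Q := (T * leaves l)%type) k); first by case.
exists (fun x => F (level_state r' k x)); split.
  apply: realizable_weaken (realizable_level (r := r') k _ Fds).
  - by rewrite mulSnr.
  - rewrite card_prod card_leaves expnS; lia.
  - by move=> i; apply: r2.
move=> x rx t.
have rx' i : `|row_eval (r' i) x| <= 2^-1 by apply: rx.
have lev q := level_product (r := r') q k0 rx'.
have half1 : 2^-1 <= 1 :> R by lra.
have {Fx} := Fx (level_state r' k x) (fun i => (lev i).1) t.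
set P := \prod_i _; set P2 := \prod_i _ => FP.
have PP : `|P - P2| <= 2 ^+ l / 4 ^+ k.
  have -> : P2 = \prod_i
      (row_eval (r' ((t, i), false)) x * row_eval (r' ((t, i), true)) x).
    rewrite [RHS](eq_bigr (fun i => \prod_(b : bool) row_eval (r' ((t, i), b)) x)).
      by rewrite pair_big; apply: eq_bigr => -[i b] _.
    by move=> i _; rewrite big_bool mulrC.
  have -> : 2 ^+ l = #|leaves l|%:R :> R by rewrite card_leaves natrX.
  apply: prod_dist_le => i.
  - exact: le_trans (lev _).1 half1.
  - by rewrite normrM mulr_ile1 // (le_trans (rx' _) half1).
  - exact: (lev _).2.
rewrite (_ : F _ t - _ = (F (level_state r' k x) t - scale t * P) + scale t * (P - P2)).
  apply: le_trans (ler_normD _ _) _.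
  rewrite exprS normrM -mulrA (mulr_natl _ 2) mulr2n mulrDr lerD //.
  by rewrite ler_wpM2l.
by ring.
Qed.
End Tree.

(** * Networks for products of affine factors *)

Section Factors.
Variable R : realType.

Definition bump_row (I Q : finType) (r : Q -> sparse_row R I) (j : Q * bool) :
    sparse_row R I :=
  row_add (r j.1) ([::], (-1) ^+ j.2 / 2).

Definition clip_row (Q : finType) (q : Q) : sparse_row R (Q * bool)%type :=
  ([:: (1, (q, false)); (-1, (q, true))], - 2^-1).

(** The projection of the real line onto [-1/2, 1/2]. *)
Definition clip (z : R) : R := relu (z + 2^-1) - relu (z - 2^-1) - 2^-1.

Lemma clip_rowE (I Q : finType) (r : Q -> sparse_row R I) x q :
  row_eval (clip_row q) (relu_layer (bump_row r) x) = clip (row_eval (r q) x).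
Proof.
rewrite /row_eval /= !big_cons big_nil /= mul1r addr0 mulN1r /clip /relu_layer.
rewrite /bump_row !row_eval_add /= expr0 expr1 /row_eval /= !big_nil !add0r.
by rewrite mulNr mul1r.
Qed.

Lemma clip_id z : `|z| <= 2^-1 -> clip z = z.
Proof.
rewrite ler_norml => /andP[z1 z2].
by rewrite /clip relu_ge0 ?relu_le0; lra.
Qed.

Lemma clip_le z : `|clip z| <= 2^-1.
Proof.
rewrite /clip ler_norml /relu.
have [h|h] := lerP (z + 2^-1) 0; have [h'|h'] := lerP (z - 2^-1) 0; lra.
Qed.

(** Clipping costs one layer and bounds the network on all inputs, also where
    it does not approximate the product. *)
Lemma clipped_product_net k l (I T : finType) (r : T * leaves l -> sparse_row R I)
    (scale : T -> R) :
  (0 < k)%N -> (forall i, (size (r i).1 <= 1)%N) ->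
  exists F : (I -> R) -> T -> R,
    realizable F (l * k.+2).+1 (#|T| * (2 ^ l * (42 + 24 * k) + 3)) /\
    forall x t, `|F x t| <= `|scale t| * (1 + 2 ^+ l / 4 ^+ k) /\
      ((forall i, `|row_eval (r (t, i)) x| <= 2^-1) ->
       `|F x t - scale t * \prod_i row_eval (r (t, i)) x|
        <= `|scale t| * (2 ^+ l / 4 ^+ k)).
Proof.
move=> k0 r1.
have [//|F [Fds FE]] := @product_tree R k l _ T (@clip_row _) scale k0.
exists (fun x => F (relu_layer (bump_row r) x)); split.
  have b1 j : (size (bump_row r j).1 <= 1)%N by rewrite /= cats0.
  apply: realizable_weaken (realizable_layer b1 Fds) => //.
  rewrite !card_prod card_leaves card_bool; lia.
move=> x t.
have cr i : row_eval (clip_row i) (relu_layer (bump_row r) x) = clip (row_eval (r i) x).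
  exact: clip_rowE.
have {FE} := FE (relu_layer (bump_row r) x).
have cs : forall i, `|row_eval (clip_row i) (relu_layer (bump_row r) x)| <= 2^-1.
  by move=> i; rewrite cr clip_le.
move=> /(_ cs t) FE; split; last first.
  move=> rx; move: FE; under eq_bigr do rewrite cr clip_id //.
  by [].
rewrite -[F _ _](subrK (scale t * \prod_i row_eval (clip_row (t, i))
  (relu_layer (bump_row r) x))).
apply: le_trans (ler_normD _ _) _; rewrite mulrDr mulr1 addrC lerD //.
rewrite normrM ler_piMr // normr_prod prodr_ile1 // => i _.
by rewrite normr_ge0 (le_trans (cs _)) //; lra.
Qed.

Lemma prod_nth_default (A : Type) (L : finType) (a0 : A) (s : seq A) (f : A -> R) :
  f a0 = 1 -> (size s <= #|L|)%N ->
  \prod_(l : L) f (nth a0 s (enum_rank l)) = \prod_(a <- s) f a.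
Proof.
move=> fa0 sL; rewrite (reindex (@enum_val L L)) /=; last first.
  by exists enum_rank => i _; [apply: enum_valK | apply: enum_rankK].
under eq_bigr do rewrite enum_valK.
rewrite (big_nth a0) -(big_mkord xpredT (fun i => f (nth a0 s i))) /=.
rewrite (big_cat_nat _ (n := size s)) //=.
rewrite [X in _ * X]big_nat_cond [X in _ * X]big1 ?mulr1 //.
by move=> i; rewrite andbT => /andP[si _]; rewrite nth_default.
Qed.

Definition factor_row (I : finType) (p : I * R) : sparse_row R I :=
  ([:: (1, p.1)], - p.2).

(** The factors are divided by 2K before the tree, which leaves those bounded
    by K unchanged under clipping, and (2K)^N is restored at the output.
    Missing factors are filled up with the constant 1. *)
Lemma factor_net k l (I T : finType) (fs : T -> seq (I * R)) (c : T -> R) (K : R) :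
  (0 < k)%N -> 1 <= K -> (forall t, (size (fs t) <= 2 ^ l)%N) ->
  (forall t, `|c t| <= 1) ->
  let e := (2 * K) ^+ (2 ^ l) * (2 ^+ l / 4 ^+ k) in
  exists F : (I -> R) -> T -> R,
    realizable F (l * k.+2).+1 (#|T| * (2 ^ l * (42 + 24 * k) + 3)) /\
    forall x t, `|F x t| <= (2 * K) ^+ (2 ^ l) + e /\
      ((forall p, p \in fs t -> `|x p.1 - p.2| <= K) ->
       `|F x t - c t * \prod_(p <- fs t) (x p.1 - p.2)| <= e).
Proof.
move=> k0 K1 szfs c1 e.
have K20 : 0 < 2 * K by lra.
pose rows t := [seq factor_row p | p <- fs t].
pose one : sparse_row R I := ([::], 1).
pose r (i : T * leaves l) :=
  row_scale (2 * K)^-1 (nth one (rows i.1) (enum_rank i.2)).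
have r1 i : (size (r i).1 <= 1)%N.
  rewrite size_map; set row := nth _ _ _.
  have [ri|ri] := ltnP (enum_rank i.2) (size (rows i.1)); last first.
    by rewrite /row nth_default.
  suff /mapP[p _ ->] : row \in rows i.1 by [].
  exact: mem_nth.
have [F [Fds FE]] := clipped_product_net (fun t => c t * (2 * K) ^+ (2 ^ l)) k0 r1.
have sc t : `|c t * (2 * K) ^+ (2 ^ l)| <= (2 * K) ^+ (2 ^ l).
  have K2N : 0 <= (2 * K) ^+ (2 ^ l) by rewrite exprn_ge0 // ltW.
  by rewrite normrM (ger0_norm K2N) ler_piMl.
have q0 : 0 <= 2 ^+ l / 4 ^+ k :> R by rewrite divr_ge0 ?exprn_ge0.
exists F; split=> // x t; have [Fle FE'] := FE x t; split.
  apply: le_trans Fle _; rewrite /e -{2}[_ ^+ (2 ^ l)]mulr1 -mulrDr ler_wpM2r //.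
move=> xK; have {FE'} := FE' _.
have -> : \prod_i row_eval (r (t, i)) x =
    (2 * K) ^- (2 ^ l) * \prod_(p <- fs t) (x p.1 - p.2).
  under eq_bigr do rewrite row_eval_scale /=.
  rewrite big_split /= prodr_const; congr (_ * _).
    by rewrite card_leaves exprVn.
  rewrite (prod_nth_default (f := fun row => row_eval row x)); last 2 first.
  - by rewrite /row_eval big_nil add0r.
  - by rewrite size_map card_leaves.
  rewrite big_map; apply: eq_bigr => p _.
  by rewrite /row_eval /= big_cons big_nil mul1r addr0.
rewrite mulrA mulfK ?expf_neq0 ?gt_eqF // => FE'; apply: le_trans (FE' _) _; last first.
  by rewrite ler_wpM2r.
move=> i; rewrite row_eval_scale /= normrM normfV (gtr0_norm K20) invfM -mulrA.
rewrite ler_piMr ?invr_ge0 // mulrC ler_pdivrMr ?mul1r; last by lra.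
set row := nth _ _ _.
have [ri|ri] := ltnP (enum_rank i) (size (rows t)); last first.
  by rewrite /row nth_default // /row_eval big_nil add0r normr1.
have /mapP[p pt ->] : row \in rows t by apply: mem_nth.
by rewrite /row_eval /= big_cons big_nil mul1r addr0 xK.
Qed.
End Factors.

(** * Integrals against the Gaussian product measure *)

Section Integrals.
Variable R : realType.

(** The Radon-Nikodym derivative of the normal distribution is its density up
    to a null set. *)
Lemma ge0_integral_normal_prob (m s : R) (f : R -> \bar R) :
  measurable_fun setT f -> (forall x, 0 <= f x)%E ->
  (\int[normal_prob m s]_x f x =
   \int[lebesgue_measure]_x (f x * (normal_pdf m s x)%:E))%E.
Proof.
move=> mf f0; have dom := @normal_prob_dominates R m s.
rewrite -(Radon_Nikodym_SigmaFinite.change_of_variables dom f0 measurableT mf).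
have intg := Radon_Nikodym_SigmaFinite.f_integrable dom.
apply: ae_eq_integral => //=.
- by apply: emeasurable_funM => //; apply: measurable_int intg.
- apply: emeasurable_funM => //; apply/measurable_EFinP.
  exact: measurable_normal_pdf.
- apply: ae_eqe_mul2l; apply: integral_ae_eq => //=.
  + apply/measurable_EFinP; exact: measurable_normal_pdf.
  + by move=> E _ mE; rewrite -Radon_Nikodym_SigmaFinite.f_integral.
Qed.

(** The weight turns the standard normal density into sqrt 2 times the normal
    density of standard deviation sqrt 2. *)
Lemma integral_normal_prob_expR_sqr :
  (\int[normal_prob 0 1]_x (expR (x ^+ 2 / 4))%:E = (Num.sqrt 2 : R)%:E)%E.
Proof.
have mf : measurable_fun setT (fun x : measurableTypeR R => (expR (x ^+ 2 / 4))%:E).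
  apply/measurable_EFinP/measurableT_comp => //.
  by apply: measurable_funM => //; apply: measurable_funX.
rewrite ge0_integral_normal_prob //.
have s2 : Num.sqrt 2 != 0 :> R by rewrite gt_eqF // sqrtr_gt0.
transitivity (\int[@lebesgue_measure R]_x
    ((Num.sqrt 2)%:E * (normal_pdf 0 (Num.sqrt 2) x)%:E))%E.
  apply: eq_integral => x _; rewrite -!EFinM; congr (_%:E).
  rewrite !normal_pdfE ?oner_neq0 // /normal_fun subr0 sqr_sqrtr //.
  rewrite mulrCA -expRD [RHS]mulrA; congr (_ * expR _).
    rewrite /normal_peak expr1n mul1r sqr_sqrtr // -mulrnAr sqrtrM //.
    by rewrite invfM mulrA mulfV // mul1r.
  by rewrite expr1n; field.
rewrite ge0_integralZl //=.
- by rewrite integral_normal_pdf mule1.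
- apply/measurable_EFinP; exact: measurable_normal_pdf.
- by move=> x _; rewrite lee_fin normal_pdf_ge0.
Qed.

Lemma measurable_coord j :
  measurable_fun setT (fun y : seqspace R => y j : measurableTypeR R).
Proof.
move=> _ B mB; rewrite setTI; apply: sub_sigma_algebra.
by exists j, B.
Qed.

(** The rectangle formula with a single coordinate identifies the marginal. *)
Lemma ge0_integral_coord (gamma : probability (seqspace R) R) j
    (f : R -> \bar R) :
  is_gaussian_product gamma -> measurable_fun setT f -> (forall x, 0 <= f x)%E ->
  (\int[gamma]_y f (y j) = \int[normal_prob 0 1]_x f x)%E.
Proof.
move=> hgamma mf f0.
have := @ge0_integral_pushforward _ _ _ _ R _ (measurable_coord j) gamma setT f
  measurableT mf (fun y _ => f0 y).
rewrite preimage_setT => <-; apply: eq_measure_integral => /=.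
  exact: measurable_coord.
move=> _ B mB _.
have := hgamma [fset j]%fset (fun=> B) (fun=> mB).
rewrite big_seq_fset1 => <-; congr (gamma _).
by apply/seteqP; split=> y /= By; [move=> i /fset1P -> | apply: By; rewrite inE].
Qed.

(** A majorant that is a sum of functions of single coordinates can be
    integrated with the marginals only. *)
Lemma Lnorm2_le (gamma : probability (seqspace R) R) (f : seqspace R -> R)
    (J : seq nat) (a c e : R) :
  is_gaussian_product gamma -> measurable_fun setT f -> 0 <= a -> 0 <= c -> 0 <= e ->
  (forall y, f y ^+ 2 <= a + \sum_(j <- J) c * expR (y j ^+ 2 / 4)) ->
  a + (size J)%:R * (c * Num.sqrt 2) <= e ^+ 2 ->
  ('N[gamma]_(2%:E)[(fun y => (f y)%:E)] <= e%:E)%E.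
Proof.
move=> hgamma mf a0 c0 e0 fle ae.
have mexp : measurable_fun setT
    (fun x : measurableTypeR R => (c * expR (x ^+ 2 / 4))%:E).
  apply/measurable_EFinP/measurable_funM => //; apply/measurableT_comp => //.
  by apply: measurable_funM => //; apply: measurable_funX.
have mexpj j : measurable_fun setT (fun y : seqspace R => (c * expR (y j ^+ 2 / 4))%:E).
  exact: (measurableT_comp mexp (measurable_coord j)).
rewrite unlock; suff h : (\int[gamma]_y (`|(f y)%:E| `^ 2) <= (e ^+ 2)%:E)%E.
  have -> : e%:E = ((e ^+ 2)%:E `^ 2^-1)%E.
    by rewrite poweR_EFin powR12_sqrt ?sqr_ge0 // sqrtr_sqr ger0_norm.
  apply: gt0_ler_poweR h => //; rewrite in_itv /= leey andbT ?lee_fin ?sqr_ge0 //.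
  by apply: integral_ge0 => y _; rewrite lee_fin powR_ge0.
have -> : (\int[gamma]_y (`|(f y)%:E| `^ 2) = \int[gamma]_y (f y ^+ 2)%:E)%E.
  apply: eq_integral => y _; rewrite [(`|_|)%E]abse_EFin poweR_EFin powR_mulrn ?normr_ge0 //.
  by rewrite real_normK ?num_real.
pose g (y : seqspace R) := (a%:E + \sum_(j <- J) (c * expR (y j ^+ 2 / 4))%:E)%E.
have mg : measurable_fun setT (fun y : seqspace R =>
    \sum_(j <- J) (c * expR (y j ^+ 2 / 4))%:E)%E.
  exact: emeasurable_sum.
have pos y : (0 <= (c * expR (y ^+ 2 / 4))%:E)%E.
  by rewrite lee_fin mulr_ge0 ?expR_ge0.
apply: (@le_trans _ _ (\int[gamma]_y g y)%E).
  apply: ge0_le_integral => //=.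
  - by move=> y _; rewrite lee_fin sqr_ge0.
  - by apply/measurable_EFinP/measurable_funX.
  - exact: emeasurable_funD.
  - by move=> y _; rewrite /g sumEFin -EFinD lee_fin.
rewrite ge0_integralD //=; last first.
  by move=> y _; apply: sume_ge0 => j _; exact: pos.
rewrite integral_cst //= probability_setT mule1.
rewrite ge0_integral_sum //=.
have E1 j : (\int[gamma]_y (c * expR (y j ^+ 2 / 4))%:E = (c * Num.sqrt 2)%:E)%E.
  rewrite (ge0_integral_coord j hgamma mexp pos).
  under eq_integral do rewrite EFinM.
  rewrite ge0_integralZl //=.
  - by rewrite integral_normal_prob_expR_sqr -EFinM.
  - apply/measurable_EFinP/measurableT_comp => //.
    by apply: measurable_funM => //; apply: measurable_funX.
under eq_bigr do rewrite E1.
rewrite sumEFin -EFinD lee_fin; apply: le_trans ae; rewrite lerD2l.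
by rewrite big_const_seq count_predT iter_addr_0 mulr_natl.
Qed.
End Integrals.

(** * Approximation error of a factored Hermite function *)

Section Pointwise.
Variable R : realType.

(** Passes from the support of one multi-index to the common index type of the
    network inputs. *)
Lemma big_finsupp_suppset (A : Type) (idx : A) (op : Monoid.com_law idx)
    (Lambda : {fset multiindex}) (nu : multiindex) (f : nat -> A) :
  nu \in Lambda -> (forall j, nu j = 0%N -> f j = idx) ->
  \big[op/idx]_(j <- finsupp nu) f j = \big[op/idx]_(i : suppset Lambda) f (val i).
Proof.
move=> nuL f0; rewrite -(big_seq_fsetE op _ xpredT f).
apply: big_fset_incl; first exact: (bigfcup_sup (fun nu : multiindex => finsupp nu) nuL).
by move=> j _ jnu; apply: f0; apply: fsfun_dflt.
Qed.

(** Coordinates outside supp nu contribute no factor, because H_0 has no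
    root. *)
Lemma hermite_mi_factored (Lambda : {fset multiindex}) (nu : multiindex) :
  nu \in Lambda ->
  exists (c : R) (fs : seq ({: suppset Lambda} * R)),
    [/\ `|c| <= 1, size fs = mi_order nu,
      {in fs, forall p, val p.1 \in finsupp nu /\ `|p.2| <= (mi_order nu)%:R} &
      forall y, hermite_mi nu y = c * \prod_(p <- fs) (y (val p.1) - p.2)].
Proof.
move=> nuL.
have [roots rootsP] := choice (hermite_factored R).
have sz n : size (roots n) = n by case: (rootsP n).
have rB n : {in roots n, forall x, `|x| <= n%:R} by case: (rootsP n).
have hE n x : hermite n x = (Num.sqrt n`!%:R)^-1 * \prod_(z <- roots n) (x - z).
  by case: (rootsP n).
have h0 x : hermite 0 x = 1 :> R.
  by rewrite hE (size0nil (sz 0%N)) big_nil fact0 sqrtr1 invr1 mulr1.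
exists (\prod_(i : suppset Lambda) (Num.sqrt (nu (val i))`!%:R)^-1).
exists [seq (i, z) | i <- enum {: suppset Lambda}, z <- roots (nu (val i))].
have order_le j : (nu j <= mi_order nu)%N.
  have [jnu|/fsfun_dflt -> //] := boolP (j \in finsupp nu).
  by rewrite /mi_order (big_fsetD1 j) //= leq_addr.
split.
- rewrite normr_prod prodr_ile1 // => i _; rewrite normr_ge0 normfV.
  rewrite ger0_norm ?sqrtr_ge0 // invf_le1 ?sqrtr_gt0 ?ltr0n ?fact_gt0 //.
  by rewrite -[leLHS]sqrtr1 ler_wsqrtr // ler1n fact_gt0.
- rewrite size_allpairs_dep sumnE big_map big_enum /=.
  by rewrite /mi_order (big_finsupp_suppset _ nuL) //; apply: eq_bigr.
- move=> p /allpairsPdep[i [z [_ zr ->]]] /=; split; last first.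
    by rewrite (le_trans (rB _ _ zr)) // ler_nat.
  rewrite mem_finsupp; apply: contraTneq zr => nui0.
  by rewrite nui0 (size0nil (sz 0%N)).
- move=> y; rewrite /hermite_mi (big_finsupp_suppset _ nuL); last first.
    by move=> j ->; rewrite h0.
  rewrite (eq_bigr (fun i => (Num.sqrt (nu (val i))`!%:R)^-1 *
    \prod_(z <- roots (nu (val i))) (y (val i) - z))) => [|i _]; last exact: hE.
  by rewrite big_split /= big_allpairs_dep big_enum.
Qed.

Lemma measurable_hermite_mi nu :
  measurable_fun setT (fun y : seqspace R => hermite_mi nu y : R).
Proof.
apply: measurable_prod => j _.
have [s [_ _ hE]] := hermite_factored R (nu j).
rewrite (_ : (fun _ => _) = fun y : seqspace R =>
    (Num.sqrt (nu j)`!%:R)^-1 * \prod_(z <- s) (y j - z)); last first.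
  by apply/funext => y; rewrite /= hE.
apply: measurable_funM => //; apply: measurable_prod => z _.
by apply: measurable_funB => //; exact: measurable_coord.
Qed.

Lemma measurable_realize n m (Phi : relu_net R n m) (x : seqspace R -> 'cV[R]_n) :
  (forall i, measurable_fun setT (fun y => x y i 0)) ->
  forall o, measurable_fun setT (fun y => realize Phi (x y) o 0).
Proof.
have affine p q (W : 'M[R]_(p, q)) b (z : seqspace R -> 'cV[R]_q) :
    (forall i, measurable_fun setT (fun y => z y i 0)) ->
    forall o, measurable_fun setT (fun y => (W *m z y + b) o 0).
  move=> mz o; rewrite (_ : (fun y => _) = fun y => \sum_j W o j * z y j 0 + b o 0).
    apply: measurable_funD => //; apply: measurable_sum => i.
    by apply: measurable_funM.
  by apply/funext => y; rewrite !mxE.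
elim: Phi x => [p q W b|p k q W b Phi IH] x mx o /=; first exact: affine.
apply: IH => i; rewrite (_ : (fun y => _) = fun y => Num.max ((W *m x y + b) i 0) 0).
  by apply: measurable_maxr => //; exact: affine.
by apply/funext => y; rewrite mxE.
Qed.

Lemma exists_argmax (J : seq nat) (g : nat -> R) j :
  j \in J -> exists2 i, i \in J & forall l, l \in J -> g l <= g i.
Proof.
elim: J j => [//|a J IH] j _.
case: J IH => [|b J] IH.
  by exists a; [rewrite mem_head | move=> l; rewrite inE => /eqP ->].
have [i iJ gi] := IH b (mem_head _ _).
have [ai|ia] := lerP (g a) (g i).
  exists i; first by rewrite inE iJ orbT.
  by move=> l; rewrite inE => /orP[/eqP -> //|]; apply: gi.
exists a; first by rewrite mem_head.
move=> l; rewrite inE => /orP[/eqP -> //|/gi gl].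
exact: le_trans gl (ltW ia).
Qed.

(** Both 36 m and 4 r are bounded by exponentials, so that the claim compares
    exponents: 36 N + 8 N r + 2 L <= r^2 / 4 holds for r >= 64 N L. *)
Lemma gaussian_weight_dominates (N m : nat) (L r : R) :
  1 <= L -> (0 < m)%N -> (m <= N)%N -> 64 * N%:R * L <= r ->
  9 * (4 * r) ^+ (2 * N) <= expR (- L) ^+ 2 / (4 * m%:R) * expR (r ^+ 2 / 4).
Proof.
move=> L1 m0 mN rB.
have N1 : 1 <= N%:R :> R by rewrite ler1n (leq_trans m0).
have mR : m%:R <= N%:R :> R by rewrite ler_nat.
have m1 : 0 < m%:R :> R by rewrite ltr0n.
have NL : N%:R <= N%:R * L by rewrite ler_peMr //; lra.
have L_NL : L <= N%:R * L by rewrite ler_peMl //; lra.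
have r64 : 64 <= r by lra.
have step1 : (4 * r) ^+ (2 * N) <= expR (8 * N%:R * r).
  have -> : 8 * N%:R * r = (4 * r) * (2 * N)%:R by rewrite natrM; ring.
  rewrite expRM_natr; apply: lerXn2r; rewrite ?nnegrE ?expR_ge0 //; first by lra.
  by apply: le_trans (expR_ge1Dx _); rewrite lerDr.
have step2 : 36 * m%:R <= expR (36 * N%:R) :> R.
  by apply: le_trans (expR_ge1Dx _); lra.
rewrite mulrAC ler_pdivlMr; last by lra.
rewrite (_ : _ * (4 * _) = (36 * m%:R) * (4 * r) ^+ (2 * N)); last by ring.
apply: (@le_trans _ _ (expR (36 * N%:R) * expR (8 * N%:R * r))).
  by apply: ler_pM => //; rewrite exprn_ge0 //; lra.
rewrite -expRM_natr -!expRD ler_expR expr2.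
have : 64 * (N%:R * L) * r <= r * r by rewrite ler_wpM2r //; lra.
have : N%:R * r <= N%:R * L * r by rewrite ler_wpM2r //; lra.
have : N%:R * L * 64 <= N%:R * L * r by rewrite ler_wpM2l //; lra.
lra.
Qed.

(** If all coordinates are at most M = 64 N L, then the factors are at most
    K = 2 M and the error is at most eps / 2.  Otherwise let r be the largest
    coordinate in absolute value.  Then H and F are bounded by (4 r)^N, up to
    a summand eps / 2, and the term of the sum at this coordinate suffices. *)
Lemma pointwise_bound (I : finType) (v : I -> nat) (N m : nat) (L : R) (J : seq nat)
    (fs : seq (I * R)) (c : R) (y : nat -> R) (F : R) :
  1 <= L -> (0 < m)%N -> (m <= N)%N -> (size fs <= N)%N -> `|c| <= 1 ->
  {in fs, forall p, v p.1 \in J /\ `|p.2| <= m%:R} ->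
  let K := 2 * (64 * N%:R * L) in
  let eps := expR (- L) in
  let H := c * \prod_(p <- fs) (y (v p.1) - p.2) in
  `|F| <= (2 * K) ^+ N + eps / 2 ->
  ((forall p, p \in fs -> `|y (v p.1) - p.2| <= K) -> `|F - H| <= eps / 2) ->
  (H - F) ^+ 2 <= (eps / 2) ^+ 2 +
    \sum_(j <- J) eps ^+ 2 / (4 * m%:R) * expR (y j ^+ 2 / 4).
Proof.
move=> L1 m0 mN szfs c1 fsP K eps H FB FK.
have N1 : 1 <= N%:R :> R by rewrite ler1n (leq_trans m0).
have mR : m%:R <= N%:R :> R by rewrite ler_nat.
have NL : N%:R <= N%:R * L by rewrite ler_peMr //; lra.
have e0 : 0 < eps by apply: expR_gt0.
have e1 : eps <= 1 by rewrite /eps expR_le1; lra.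
have c0 : 0 <= eps ^+ 2 / (4 * m%:R) by rewrite divr_ge0 ?sqr_ge0 // mulr_ge0.
have sum0 (s : seq nat) :
    0 <= \sum_(j <- s) eps ^+ 2 / (4 * m%:R) * expR (y j ^+ 2 / 4).
  by apply: sumr_ge0 => j _; rewrite mulr_ge0 ?expR_ge0.
have sqr_le (a b : R) : `|a| <= b -> a ^+ 2 <= b ^+ 2.
  move=> ab; rewrite -real_normK ?num_real // lerXn2r // nnegrE ?normr_ge0 //.
  exact: le_trans (normr_ge0 _) ab.
have [inbox|] := boolP (all (fun j => `|y j| <= 64 * N%:R * L) J).
  rewrite -[leLHS]addr0 lerD //; apply: sqr_le; rewrite distrC; apply: FK => p pfs.
  have [vJ p2] := fsP _ pfs; have := allP inbox _ vJ.
  by have := ler_normB (y (v p.1)) p.2; rewrite /K; lra.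
rewrite -has_predC => /hasP[j0 j0J /=]; rewrite -ltNge => yj0.
have [i iJ] := exists_argmax (fun j => `|y j|) j0J; set r := `|y i| => rmax.
have rM : 64 * N%:R * L < r by apply: lt_le_trans yj0 (rmax _ j0J).
have r4 : 1 <= 4 * r by lra.
have HB : `|H| <= (4 * r) ^+ N.
  rewrite normrM; apply: le_trans (ler_piMl _ c1) _; first exact: normr_ge0.
  rewrite normr_prod; apply: (@le_trans _ _ (\prod_(p <- fs) (4 * r))).
    rewrite !big_seq; apply: ler_prod => p pfs; rewrite normr_ge0 /=.
    have [vJ p2] := fsP _ pfs; have := rmax _ vJ.
    by have := ler_normB (y (v p.1)) p.2; lra.
  by rewrite big_const_seq count_predT iter_mulr_1 ler_weXn2l.
have KB : (2 * K) ^+ N <= (4 * r) ^+ N.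
  by apply: lerXn2r; rewrite ?nnegrE /K; lra.
have rN1 : 1 <= (4 * r) ^+ N by rewrite exprn_ege1.
have HF : `|H - F| <= 3 * (4 * r) ^+ N by have := ler_normB H F; lra.
apply: le_trans (sqr_le _ _ HF) _; rewrite exprMn -exprM mulnC.
rewrite (_ : 3 ^+ 2 = 9); last by ring.
have := gaussian_weight_dominates L1 m0 mN (ltW rM).
rewrite -/eps real_normK ?num_real // => w; apply: le_trans w _.
rewrite (big_rem i) //= -[leLHS]add0r lerD ?sqr_ge0 // lerDl.
exact: sum0.
Qed.
End Pointwise.

(** * Choice of the parameters *)

Section Tuning.
Variable R : realType.

Lemma ln2_ge_half : 2^-1 <= ln 2 :> R.
Proof.
have h : -1 < - 2^-1 :> R by lra.
have := le_ln1Dx h; rewrite (_ : 1 - 2^-1 = 2^-1); last by lra.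
by rewrite lnV ?posrE //; lra.
Qed.

Lemma expR_nat_le k : expR k%:R <= 4 ^+ k :> R.
Proof.
rewrite -[k%:R]mul1r expRM_natr; apply: lerXn2r; rewrite ?nnegrE ?expR_ge0 //.
have -> : (4 : R) = expR (ln 2 *+ 2).
  by rewrite -lnXn // lnK ?posrE //; lra.
by rewrite ler_expR mulr2n; have := ln2_ge_half; lra.
Qed.

(** Here exp(E) with E = N ln(256 N L) + 2 N + L majorizes
    2 exp(L) N (256 N L)^N, and k is the first integer above E. *)
Lemma tree_parameters (m : nat) (L : R) :
  (0 < m)%N -> 1 <= L ->
  let lam := ln (1 + m%:R) in
  exists l k : nat, [/\ (m <= 2 ^ l)%N, (2 ^ l <= 2 * m)%N & (0 < k)%N] /\
    [/\ l%:R <= 4 * lam, k.+2%:R <= 40 * (m%:R * lam * L) &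
     (2 * (2 * (64 * (2 ^ l)%:R * L))) ^+ (2 ^ l) * (2 ^+ l / 4 ^+ k)
       <= expR (- L) / 2].
Proof.
move=> m0 L1 lam.
have m1 : 1 <= m%:R :> R by rewrite ler1n.
have l2 := ln2_ge_half.
have lam2 : ln 2 <= lam by rewrite /lam ler_ln ?posrE; lra.
(* The power of 2 in ]m, 2 m]. *)
pose l := (trunc_log 2 m).+1; pose N := (2 ^ l)%N.
have /andP[lo hi] := trunc_log_bounds (isT : (1 < 2)%N) m0.
have mN : (m <= N)%N by apply: ltnW.
have Nm : (N <= 2 * m)%N by rewrite /N expnS leq_mul2l lo orbT.
have N1 : 1 <= N%:R :> R by rewrite ler1n expn_gt0.
have Nm' : N%:R <= 2 * m%:R :> R by rewrite -natrM ler_nat.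
(* 2 m <= (1 + m)^2 *)
have lnN : ln N%:R <= 2 * lam.
  rewrite mulr_natl /lam -lnXn; last by lra.
  rewrite ler_ln ?posrE; [|lra|by rewrite exprn_gt0 //; lra].
  by apply: le_trans Nm' _; rewrite expr2; nra.
have lnL : ln L <= L.
  by have := @le_ln1Dx R (L - 1); rewrite subrKC; lra.
have ll : l%:R <= 4 * lam.
  have : l%:R * ln 2 <= 2 * lam by rewrite mulr_natl -lnXn // -natrX.
  nra.
pose E := N%:R * ln (256 * N%:R * L) + 2 * N%:R + L.
have NLpos : 0 < N%:R * L by rewrite mulr_gt0; lra.
have NL0 : 0 < 256 * N%:R * L by lra.
have ln256 : ln (256 * N%:R * L) <= 10 * lam + L.
  have -> : 256 * N%:R * L = 2 ^+ 8 * (N%:R * L) by ring.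
  rewrite (lnM (x := 2 ^+ 8)) ?posrE ?exprn_gt0 // (lnM (x := N%:R)) ?posrE; try lra.
  by rewrite lnXn // -[_ *+ 8]mulr_natl; lra.
have NL : N%:R <= N%:R * L by rewrite ler_peMr //; lra.
have lnNL0 : 0 <= N%:R * ln (256 * N%:R * L).
  by rewrite mulr_ge0 ?ln_ge0 //; lra.
have E0 : 0 <= E by rewrite /E; lra.
pose k := (Num.truncn E).+1.
have Ek : E <= k%:R by apply/ltW/truncnS_gt.
have kE : k%:R <= E + 1.
  by rewrite /k -natr1 lerD2r; have /andP[] := truncn_itv E0.
exists l, k; split; first by split.
split=> //.
- rewrite -addn2 natrD.
  set X := m%:R * lam * L.
  have lam_half : 2^-1 <= lam by lra.
  have mL0 : 0 <= m%:R * L by rewrite mulr_ge0; lra.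
  have mlam0 : 0 <= m%:R * lam by rewrite mulr_ge0; lra.
  have mlL : m%:R * lam <= X by rewrite /X ler_peMr.
  have mL : m%:R * L * 2^-1 <= X by rewrite /X (mulrAC m%:R lam L) ler_wpM2l.
  have mm : m%:R * 2^-1 <= m%:R * lam by rewrite ler_wpM2l //; lra.
  have Lm : L <= m%:R * L by rewrite ler_peMl //; lra.
  have : N%:R * ln (256 * N%:R * L) <= 2 * m%:R * (10 * lam + L).
    apply: ler_pM => //; rewrite ln_ge0 //; lra.
  by rewrite /E in kE; lra.
- rewrite (mulrA _ (2 ^+ l)) ler_pdivrMr ?exprn_gt0 //.
  have -> : 2 * (2 * (64 * N%:R * L)) = 256 * N%:R * L by ring.
  have -> : 2 ^+ l = N%:R :> R by rewrite natrX.
  have NE : N%:R <= expR (N%:R) :> R.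
    by apply: le_trans (expR_ge1Dx _); lra.
  have h1 : expR (- L) / 2 * expR E <= expR (- L) / 2 * 4 ^+ k.
    rewrite ler_wpM2l ?divr_ge0 ?expR_ge0 //.
    by apply: le_trans (expR_nat_le k); rewrite ler_expR.
  apply: le_trans h1; rewrite /E !expRD.
  rewrite expRM_natl lnK ?posrE // (mulr_natl N%:R 2) mulr2n expRD.
  have -> : expR (- L) / 2 * ((256 * N%:R * L) ^+ N * (expR N%:R * expR N%:R) * expR L)
     = (256 * N%:R * L) ^+ N * (expR N%:R * expR N%:R / 2) * (expR (- L) * expR L).
    by move: (expR (- L)) (expR L) (expR _) (_ ^+ _) => a b c d; field.
  rewrite -(expRD (- L)) addNr expR0 mulr1 ler_wpM2l ?exprn_ge0 ?(ltW NL0) //.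
  have : 2 <= expR N%:R :> R by apply: le_trans (expR_ge1Dx _); lra.
  move=> e2; have : N%:R * 2 <= expR N%:R * expR N%:R :> R by apply: ler_pM => //; lra.
  lra.
Qed.
End Tuning.

(** * Assembly *)

Section Assembly.
Variable R : realType.

Lemma realizable_components (Lambda : {fset multiindex}) F d s :
  realizable (R := R) (I := {: suppset Lambda}) (O := {: Lambda}) F d s ->
  exists Phi : relu_net R #|{: suppset Lambda}| #|{: Lambda}|,
    [/\ net_depth Phi = d, (net_size Phi <= s)%N &
      forall (nu : Lambda) y, net_component Phi nu y = F (fun i => y (val i)) nu].
Proof.
by case=> Phi [dPhi sPhi PhiE]; exists Phi; split=> // nu y; rewrite -PhiE.
Qed.

Lemma bigmaxe_le (I : finType) (f : I -> \bar R) (e : \bar R) :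
  (0 <= e)%E -> (forall i, f i <= e)%E -> (\big[maxe/0]_i f i <= e)%E.
Proof.
move=> e0 fe; apply: (big_ind (fun x => x <= e)%E) => // x y xe ye.
by rewrite ge_max xe ye.
Qed.

Lemma max_order0_eq (Lambda : {fset multiindex}) :
  max_order Lambda = 0%N -> forall nu, nu \in Lambda -> nu = [fsfun].
Proof.
move=> m0 nu nuL; apply/fsfunP => j; rewrite fsfunE.
have [jnu|/fsfun_dflt -> //] := boolP (j \in finsupp nu).
have : (mi_order nu <= max_order Lambda)%N.
  by rewrite /max_order; apply: (leq_bigmax_seq (F := mi_order)).
by rewrite m0 leqn0 /mi_order (big_fsetD1 j) //= addn_eq0 => /andP[/eqP].
Qed.

Lemma eff_dim_gt0 (Lambda : {fset multiindex}) :
  (0 < max_order Lambda)%N -> (0 < eff_dim Lambda)%N.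
Proof.
rewrite !lt0n; apply: contra_neq => d0; apply/eqP; rewrite -leqn0.
apply/bigmax_leqP_seq => nu nuL _; rewrite leqn0.
have : (#|` finsupp nu| <= eff_dim Lambda)%N.
  exact: (leq_bigmax_seq (F := fun nu : multiindex => #|` finsupp nu|)).
by rewrite d0 leqn0 cardfs_eq0 => /eqP nu0; rewrite /mi_order nu0 big_seq_fset0.
Qed.

Lemma constant_hermite_net (Lambda : {fset multiindex})
    (gamma : probability (seqspace R) R) :
  max_order Lambda = 0%N ->
  exists Phi : relu_net R #|{: suppset Lambda}| #|{: Lambda}|,
    [/\ net_depth Phi = 0%N, (net_size Phi <= #|{: Lambda}|)%N &
     forall nu : Lambda, ('N[gamma]_(2%:E)[(fun y => (hermite_mi (val nu) y
                                         - net_component Phi nu y)%:E)] = 0)%E].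
Proof.
move=> m0.
pose one (nu : {: Lambda}) : sparse_row R {: suppset Lambda} := ([::], 1).
have [//|Phi [dPhi sPhi PhiE]] := realizable_components (@realizable_affine R _ _ one 0 _).
exists Phi; split=> //; first by rewrite muln1 in sPhi.
move=> nu; rewrite -[RHS](@Lnorm0 _ _ _ gamma 2%:E) //.
apply: eq_Lnorm => y; rewrite PhiE /row_eval big_nil add0r.
rewrite (max_order0_eq m0 (valP nu)) /hermite_mi finsupp0 big_seq_fset0.
by rewrite subrr.
Qed.

(** For each nu the factors of all coordinates form one product, so that depth
    and size per component depend on max_order and eps only. *)
Lemma hermite_net (gamma : probability (seqspace R) R)
    (Lambda : {fset multiindex}) (L : R) :
  is_gaussian_product gamma -> (0 < max_order Lambda)%N -> 1 <= L ->
  let m := (max_order Lambda)%:R in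
  let lam := ln (1 + m) in
  exists Phi : relu_net R #|{: suppset Lambda}| #|{: Lambda}|,
    [/\ forall nu : Lambda,
        ('N[gamma]_(2%:E)[(fun y => (hermite_mi (val nu) y
            - net_component Phi nu y)%:E)] <= (expR (- L))%:E)%E,
      (net_size Phi)%:R <= #|{: Lambda}|%:R * (2000 * (m ^+ 2 * lam * L)) &
      (net_depth Phi)%:R <= 170 * (m * lam ^+ 2 * L)].
Proof.
move=> hgamma m0 L1 m lam.
have [l [k [[mN Nm k0] [ll kk ek]]]] := tree_parameters m0 L1.
set N := (2 ^ l)%N in mN Nm ek; pose K := 2 * (64 * N%:R * L).
have order_le (nu : Lambda) : (mi_order (val nu) <= max_order Lambda)%N.
  by apply: (leq_bigmax_seq (F := mi_order)) => //; apply: valP.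
have /choice[cf cfP] : forall nu : Lambda,
    exists cf : R * seq ({: suppset Lambda} * R),
    [/\ `|cf.1| <= 1, size cf.2 = mi_order (val nu),
      {in cf.2, forall p, val p.1 \in finsupp (val nu) /\
        `|p.2| <= (mi_order (val nu))%:R} &
      forall y, hermite_mi (val nu) y = cf.1 * \prod_(p <- cf.2) (y (val p.1) - p.2)].
  move=> nu; have [c [fs ?]] := hermite_mi_factored R (valP nu).
  by exists (c, fs).
have N1 : 1 <= N%:R :> R by rewrite ler1n expn_gt0.
have NL : N%:R <= N%:R * L by rewrite ler_peMr //; lra.
have K1 : 1 <= K by rewrite /K; lra.
have szfs nu : (size (cf nu).2 <= N)%N.
  by case: (cfP nu) => _ -> _ _; apply: leq_trans mN.
have c1 nu : `|(cf nu).1| <= 1 by case: (cfP nu).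
have [F [Fds FE]] := factor_net k0 K1 szfs c1.
have [Phi [dPhi sPhi PhiE]] := realizable_components Fds.
have m1 : 1 <= m by rewrite ler1n.
have lam_half : 2^-1 <= lam.
  by apply: le_trans (ln2_ge_half R) _; rewrite /lam ler_ln ?posrE; lra.
have lam0 : 0 <= lam by lra.
exists Phi; split.
- move=> nu; case: (cfP nu) => _ szE fsP hE.
  have e0 : 0 < expR (- L) by apply: expR_gt0.
  have mes : measurable_fun setT
      (fun y : seqspace R => hermite_mi (val nu) y - net_component Phi nu y).
    apply: measurable_funB; first exact: measurable_hermite_mi.
    apply: measurable_realize => i.
    rewrite (_ : (fun y => _) = fun y : seqspace R => y (val (enum_val i))).
      exact: measurable_coord.
    by apply/funext => y; rewrite mxE.
  (* The sum has at most m terms with integral eps^2 sqrt 2 / (4 m) each, so that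
     the squared norm is at most eps^2 / 4 + eps^2 / 2. *)
  apply: (Lnorm2_le (J := finsupp (val nu)) (a := (expR (- L) / 2) ^+ 2)
    (c := expR (- L) ^+ 2 / (4 * m)) hgamma mes).
  + exact: sqr_ge0.
  + by rewrite divr_ge0 ?sqr_ge0 // mulr_ge0 //; lra.
  + exact: ltW.
  + move=> y; rewrite hE PhiE.
    have [F1 F2] := FE (fun i => y (val i)) nu.
    apply: (pointwise_bound (N := N) (v := fun i : {: suppset Lambda} => val i)) => //.
    * move=> p /fsP[pJ pB]; split=> //; apply: le_trans pB _.
      by rewrite ler_nat.
    * by apply: le_trans F1 _; rewrite lerD2l.
    * by move=> pK; apply: le_trans (F2 pK) _.
  + have szJ : (size (finsupp (val nu)))%:R <= m.
      rewrite ler_nat; apply: leq_trans (order_le nu).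
      rewrite /mi_order -sum1_size !big_seq; apply: leq_sum => j.
      by rewrite mem_finsupp lt0n.
    have s2 : Num.sqrt 2 <= 2 :> R.
      by rewrite -[leRHS]ger0_norm // -sqrtr_sqr ler_wsqrtr // expr2; lra.
    have s0 : 0 <= Num.sqrt 2 :> R by apply: sqrtr_ge0.
    set e := expR (- L) in e0 *.
    have : (size (finsupp (val nu)))%:R * (e ^+ 2 / (4 * m) * Num.sqrt 2)
        <= m * (e ^+ 2 / (4 * m) * 2).
      have c0 : 0 <= e ^+ 2 / (4 * m) by rewrite divr_ge0 ?sqr_ge0 //; lra.
      by apply: ler_pM => //; [apply: mulr_ge0 | apply: ler_wpM2l].
    have -> : m * (e ^+ 2 / (4 * m) * 2) = e ^+ 2 / 2.
      by have : m != 0 by [rewrite gt_eqF //; lra]; move=> ?; field.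
    have := sqr_ge0 e; rewrite exprMn exprVn !expr2; lra.
- apply: le_trans (_ : (#|{: Lambda}| * (N * (42 + 24 * k) + 3))%:R <= _).
    by rewrite ler_nat.
  rewrite natrM ler_wpM2l // natrD natrM natrD natrM.
  have Nm' : N%:R <= 2 * m by rewrite -natrM ler_nat.
  move: kk; rewrite -addn2 natrD -/m -/lam; set X := m * lam * L => kk.
  have -> : m ^+ 2 * lam * L = m * X by rewrite /X expr2 !mulrA.
  have X_half : 2^-1 <= X.
    have mlam : lam <= m * lam by rewrite ler_peMl.
    have : m * lam <= X by rewrite ler_peMr // mulr_ge0 //; lra.
    lra.
  have mX : X <= m * X by rewrite ler_peMl //; lra.
  have : N%:R * (42 + 24 * k%:R) <= 2 * m * (960 * X) by apply: ler_pM => //; lra.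
  lra.
- rewrite dPhi -natr1 natrM.
  have -> : m * lam ^+ 2 * L = lam * (m * lam * L) by rewrite expr2; ring.
  move: ll kk; rewrite -/m -/lam; set X := m * lam * L => ll kk.
  have X_half : 2^-1 <= X.
    have mlam : lam <= m * lam by rewrite ler_peMl.
    have : m * lam <= X by rewrite ler_peMr // mulr_ge0 //; lra.
    lra.
  have : l%:R * k.+2%:R <= 4 * lam * (40 * X) by apply: ler_pM.
  have : 2^-1 * 2^-1 <= lam * X by apply: ler_pM => //; lra.
  lra.
Qed.
End Assembly.

Theorem theorem3p7 (R : realType) (gamma : probability (seqspace R) R)
    (hgamma : is_gaussian_product gamma) :
  exists C : R, 0 < C /\
    forall Lambda : {fset multiindex}, downward_closed Lambda ->
    forall eps : R, 0 < eps -> eps < expR (-1) ->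
    exists Phi : relu_net R #|{: suppset Lambda}| #|{: Lambda}|,
      [/\ (\big[maxe/0]_(nu : Lambda)
             'N[gamma]_(2%:E)[(fun y => (hermite_mi (val nu) y
                                         - net_component Phi nu y)%:E)]
           <= eps%:E)%E,
                                                                        
                                                                     
          Lambda <> [fset [fsfun]]%fset ->
          (net_size Phi)%:R <=
            C * #|` Lambda|%:R * (max_order Lambda)%:R ^+ 3
              * ln (1 + (max_order Lambda)%:R)
              * (eff_dim Lambda)%:R ^+ 2 * ln (eps^-1)
        & (net_depth Phi)%:R <=
            C * (max_order Lambda)%:R
              * ln (1 + (max_order Lambda)%:R) ^+ 2
              * (eff_dim Lambda)%:R * ln (1 + (eff_dim Lambda)%:R)
              * ln (eps^-1) ].
Proof.
have [C [CE C0]] : exists C : R, C = 2000 /\ 0 < C by exists 2000; rewrite ltr0n.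
exists C; split=> // Lambda _ eps eps0 eps1.
have cardL : #|` Lambda| = #|{: Lambda}| by rewrite cardfE.
(* If all orders vanish, then Lambda is empty or consists of the zero
   multi-index, and a constant network without hidden layer is exact. *)
have [m0|] := posnP (max_order Lambda).
  have [Phi [dPhi sPhi PhiN]] := constant_hermite_net gamma m0.
  exists Phi; split.
  - by apply: bigmaxe_le => [|nu]; rewrite ?PhiN lee_fin ltW.
  - move=> L0; have /eqP L_empty : Lambda == fset0.
      apply: contra_notT L0 => /fset0Pn[nu nuL].
      apply/fsetP => mu; rewrite inE; apply/idP/eqP => [|->].
        exact: (max_order0_eq m0).
      by rewrite -(max_order0_eq m0 nuL).
    have : (net_size Phi <= 0)%N.
      by apply: leq_trans sPhi _; rewrite -cardL L_empty cardfs0.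
    by rewrite leqn0 => /eqP ->; rewrite L_empty cardfs0 mulr0 !mul0r.
  - by rewrite dPhi m0 mulr0 !mul0r.
move=> m0; set L := ln eps^-1.
have L1 : 1 <= L.
  have : ln eps < ln (expR (-1)) by rewrite ltr_ln ?posrE ?expR_gt0.
  by rewrite expRK /L lnV ?posrE //; lra.
have epsE : expR (- L) = eps by rewrite /L lnV ?opprK ?lnK ?posrE.
have [Phi [PhiN sPhi dPhi]] := hermite_net hgamma m0 L1.
set m := (max_order Lambda)%:R in sPhi dPhi *.
set lam := ln (1 + m) in sPhi dPhi *.
set d := (eff_dim Lambda)%:R.
have m1 : 1 <= m by rewrite ler1n.
have d1 : 1 <= d.
  by rewrite ler1n eff_dim_gt0.
have lam0 : 0 <= lam by rewrite ln_ge0 //; lra.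
have L0 : 0 <= L by lra.
have lnd : 2^-1 <= ln (1 + d).
  by apply: le_trans (ln2_ge_half R) _; rewrite ler_ln ?posrE; lra.
exists Phi; split.
- by apply: bigmaxe_le => [|nu]; rewrite -epsE ?lee_fin ?expR_ge0.
- move=> _; rewrite -CE in sPhi; apply: le_trans sPhi _; rewrite cardL.
  set T := #|_|%:R.
  have X0 : 0 <= T * (C * (m ^+ 2 * lam * L)).
    by rewrite !mulr_ge0 ?sqr_ge0 ?ler0n // ltW.
  rewrite [leRHS](_ : _ = T * (C * (m ^+ 2 * lam * L)) * (m * d ^+ 2)); last by ring.
  by rewrite ler_peMr // mulr_ege1 // exprn_ege1.
- apply: le_trans dPhi _.
  have X0 : 0 <= m * lam ^+ 2 * L by rewrite !mulr_ge0 ?sqr_ge0 //; lra.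
  rewrite [leRHS](_ : _ = (m * lam ^+ 2 * L) * (C * (d * ln (1 + d)))); last by ring.
  have dl : 1 * 2^-1 <= d * ln (1 + d) by apply: ler_pM => //; lra.
  have : C * (1 * 2^-1) <= C * (d * ln (1 + d)) by rewrite ler_wpM2l // ltW.
  by move=> Cdl; rewrite mulrC ler_wpM2l //; lra.
Qed.
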